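(* Let $\varphi\colon\mathbb{N}\to\mathbb{R}^+$ be a function satisfying $\lim_{n\to\infty}\varphi(n)=\infty$. Then the sets $$\left\{x\in(0,1)\setminus\mathbb{Q}\colon\lim_{n\to\infty}\frac{\log\frac{q_n(x)}{q_{n-1}(x)}}{\varphi(n)}=1\right\}\quad\text{and}\quad\left\{x\in(0,1)\setminus\mathbb{Q}\colon\lim_{n\to\infty}\frac{\log\frac{\widetilde{q}_n(x)}{\widetilde{q}_{n-1}(x)}}{\varphi(n)}=1\right\}$$ coincide and have Hausdorff dimension $\frac{1}{1+\theta}$, where $$\theta=\limsup_{n\to\infty}\frac{\sum_{k=1}^{n+1}\varphi(k)}{\sum_{k=1}^{n}(n-k+1)\varphi(k)},$$ with the convention that $\frac{1}{1+\theta}=0$ if $\theta=\infty$. Here $q_n(x)$ and $\widetilde{q}_n(x)$ denote the $n$th digits of the Pierce expansion of $x$ in the Perron notation and in the traditional notation, respectively.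
   Context: $\mathbb{N}=\{1,2,3,\dots\}$. Pierce expansion in the Perron notation: every $x\in(0,1)\setminus\mathbb{Q}$ has a unique representation $$x=\frac{1}{q_1-1}-\frac{1}{(q_1-1)(q_2-1)}+\frac{1}{(q_1-1)(q_2-1)(q_3-1)}-\cdots$$ as an infinite series, with natural numbers $q_1\ge2$ and $q_{n+1}\ge q_n+1$ for all $n$; put $q_n(x)=q_n$. Pierce expansion in the traditional notation: the same expansion written as $$x=\frac{1}{\widetilde{q}_1}-\frac{1}{\widetilde{q}_1\widetilde{q}_2}+\cdots+\frac{(-1)^{n-1}}{\widetilde{q}_1\cdots\widetilde{q}_n}+\cdots,$$ so that $\widetilde{q}_n(x)=q_n(x)-1$ for all $n$. *)

(* Defs.v *)
From mathcomp Require Import all_boot all_order all_algebra.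
From mathcomp Require Import all_classical all_reals all_analysis.
Set Implicit Arguments.
Unset Strict Implicit.
Unset Printing Implicit Defensive.
Import Order.TTheory GRing.Theory Num.Theory.
Import numFieldNormedType.Exports.
Local Open Scope classical_set_scope.
Local Open Scope ring_scope.

(** * Pierce expansions *)

(* In both predicates the sequence starts at index 0: its entry of index k is
   the digit of index k + 1 of the expansion. *)
Definition pierce_perron_expansion {R : realType} (x : R) (q : nat -> nat) :
    Prop :=
  [/\ (2 <= q 0)%N,
      forall k, (q k + 1 <= q k.+1)%N &
      series (fun k => (-1) ^+ k / \prod_(i < k.+1) ((q i)%:R - 1)) @ \oo --> x].

Definition pierce_expansion {R : realType} (x : R) (q : nat -> nat) : Prop :=
  [/\ (1 <= q 0)%N,
      forall k, (q k + 1 <= q k.+1)%N &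
      series (fun k => (-1) ^+ k / \prod_(i < k.+1) (q i)%:R) @ \oo --> x].

(* The digits q_n(x), n >= 1.  The expansion exists and is unique for every
   irrational x in (0, 1), and xget selects it; the values at n = 0 and at the
   other x are irrelevant. *)
Definition pierce_perron_digit {R : realType} (n : nat) (x : R) : nat :=
  xget (fun=> 0%N) [set q | pierce_perron_expansion x q] n.-1.

Definition pierce_digit {R : realType} (n : nat) (x : R) : nat :=
  xget (fun=> 0%N) [set q | pierce_expansion x q] n.-1.

(** * Hausdorff dimension of subsets of the real line *)

Section Hausdorff.
Context {R : realType}.
Local Open Scope ereal_scope.

(* The maximum with 0 gives diam(set0) = 0, since ereal_sup set0 = -oo. *)
Definition diameter (U : set R) : \bar R :=
  maxe 0 (ereal_sup [set `|p.1 - p.2|%:E | p in U `*` U]).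

(* diam(U)^s with the conventions diam(set0)^s = 0 (also for s = 0) and
   diam(U)^0 = 1 for U nonempty. *)
Definition diameter_pow (s : R) (U : set R) : \bar R :=
  if pselect (U = set0) then 0 else diameter U `^ s.

(* Finite covers are included, as the F k may be empty. *)
Definition hausdorff_premeasure (s delta : R) (A : set R) : \bar R :=
  ereal_inf [set \sum_(0 <= k <oo) diameter_pow s (F k) |
    F in [set F : nat -> set R | A `<=` \bigcup_k F k /\
                                 forall k, diameter (F k) <= delta%:E]].

(* The premeasure is nonincreasing in delta, so its limit as delta -> 0 is a
   supremum. *)
Definition hausdorff_measure (s : R) (A : set R) : \bar R :=
  ereal_sup [set hausdorff_premeasure s delta A |
    delta in [set delta : R | (0 < delta)%R]].

Definition hausdorff_dim (A : set R) : \bar R :=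
  ereal_inf [set s%:E |
    s in [set s : R | (0 <= s)%R /\ hausdorff_measure s A = 0]].

End Hausdorff.

(* Main.v *)
Require Import Defs.
From mathcomp Require Import all_boot all_order all_algebra.
From mathcomp Require Import all_classical all_reals all_analysis.
From mathcomp Require Import ring lra zify.
Import Order.TTheory GRing.Theory Num.Theory.
Import numFieldNormedType.Exports.
Local Open Scope classical_set_scope.
Local Open Scope ring_scope.

(** Write p_1 < p_2 < ... for the digits of x in the traditional notation,
    Phi(n) = phi(1) + ... + phi(n) and S(n) = Phi(1) + ... + Phi(n); exchanging
    the order of summation shows that theta = limsup Phi(n+1) / S(n).

    The digits of the two notations differ by 1, which moves log (q_n / q_(n-1))
    by at most log 2, and this is negligible against phi(n); hence the two sets
    are the same set E, called pierce_growth below. Uniqueness of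
    the expansion identifies the digits of x. A point without an expansion has
    all its digits equal to 0 by default, so its quotient is constantly 0 and
    does not tend to 1. Conversely every x that has an infinite expansion is
    irrational and lies in (0, 1).

    Along a point of E the logarithm of p_n is asymptotic to Phi(n), so that of
    the product p_1 ... p_n is asymptotic to S(n). Up to factors exp(o(S(n))),
    there are exp(S(n)) admissible words p_1 ... p_n, and the points of E that
    share such a word lie in an interval of length about
    1 / (p_1 ... p_n p_(n+1)) = exp(- S(n) - Phi(n+1)). Hence the dimension
    should be liminf S(n) / (S(n) + Phi(n+1)) = 1 / (1 + theta).

    Upper bound (pierce_growth_null). E is a countable union of classes on which
    the asymptotics of the digits hold with uniform constants, and each class is
    covered by its cylinders of order n. If s (1 + t) > 1 and
    Phi(n+1) >= t S(n) for infinitely many n, the total s-cost of these covers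
    tends to 0 along such n.

    Lower bound (pierce_growth_measure_neq0). Let p_n range over the integers
    from a_n to 2 a_n - 1, where a_n is a product over k <= n of integers
    comparable to exp(phi(k)). Each p_n has a_n possible values, so the digits
    d_n = p_n - a_n can be read as the digits of a number u in [0, 1) in the
    mixed radix (a_n). This gives a map g from [0, 1) to E, and two points g u
    and g v whose expansions first differ at the digit n are far enough apart
    for |u - v| <= C |g u - g v|^s to hold as soon as
    1 / (a_1 ... a_(n-1)) <= C' (2^n a_1 ... a_n)^(-s) for all n; this follows
    from Phi(n) <= t S(n-1) for large n and s (1 + t) < 1. A cover of E by sets
    U_k pulls back to a cover of [0, 1) by sets that lie in intervals of length
    2 C diam(U_k)^s, and the Lebesgue measure of [0, 1) bounds the s-cost of the
    cover from below. *)

(** * Bounds, uniqueness and existence of Pierce expansions *)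

Definition pierce_term {R : realType} (p : nat -> nat) (k : nat) : R :=
  (-1) ^+ k / \prod_(i < k.+1) (p i)%:R.

Definition shift (n : nat) (p : nat -> nat) : nat -> nat := fun k => p (n + k)%N.

(** The relation x = (1 - x') / p_1 between x and its tail x', on the level of
    partial sums; it is the source of all the properties of expansions below. *)
Lemma pierce_series_shift {R : realType} (p : nat -> nat) n :
  series (@pierce_term R p) n.+1 =
  (1 - series (pierce_term (shift 1 p)) n) / (p 0%N)%:R.
Proof.
rewrite /series /= big_nat_recl// {1}/pierce_term expr0 big_ord1 mulrBl.
rewrite mulr_suml -sumrN; congr (_ + _); apply: eq_bigr => k _.
by rewrite /pierce_term exprS mulN1r big_ord_recl invfM mulNr mulrA mulrAC.
Qed.

Lemma pierce_digit_lb (p : nat -> nat) : (1 <= p 0%N)%N ->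
  (forall k, (p k + 1 <= p k.+1)%N) -> forall k, (k < p k)%N.
Proof. by move=> p0 pS; elim=> // k IH; have := pS k; lia. Qed.

Lemma shift1_gt (p : nat -> nat) : (forall k, (p k + 1 <= p k.+1)%N) ->
  (p 0%N < shift 1 p 0%N)%N.
Proof. by move=> pS; rewrite -addn1; exact: pS. Qed.

Section Bounds.
Context {R : realType}.
Implicit Types (x y : R) (p : nat -> nat).

(** By induction on n for all digit sequences at once, since the tail of the
    series has the same form. *)
Lemma pierce_series_bounds p n : (1 <= p 0%N)%N ->
  (forall k, (p k + 1 <= p k.+1)%N) ->
  0 <= series (@pierce_term R p) n <= (p 0%N)%:R^-1.
Proof.
elim: n p => [|n IH] p p0 pS.
  by rewrite /series /= big_geq// lexx invr_ge0 ler0n.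
rewrite pierce_series_shift.
have p1 : (2 <= shift 1 p 0%N)%N by have := shift1_gt _ pS; lia.
have /andP[h0 h1] := IH (shift 1 p) (ltnW p1) (fun k => pS _).
have p0' : 0 < (p 0%N)%:R^-1 :> R by rewrite invr_gt0 ltr0n.
have h2 : series (@pierce_term R (shift 1 p)) n <= 1.
  by rewrite (le_trans h1)// invf_le1 ?ler1n ?ltr0n// ltnW.
by rewrite mulr_ge0 ?subr_ge0 ?(ltW p0')//= ger_pMl// lerBlDr lerDl.
Qed.

Lemma pierce_expansion_tail x p : pierce_expansion x p ->
  pierce_expansion (1 - (p 0%N)%:R * x) (shift 1 p).
Proof.
move=> [p0 pS px]; split; first by have := shift1_gt _ pS; lia.
  by move=> k; exact: pS.
have p0' : (p 0%N)%:R != 0 :> R by rewrite pnatr_eq0 -lt0n.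
rewrite [X in X @ _ --> _](_ : _ =
    (fun n => 1 - (p 0%N)%:R * [sequence series (@pierce_term R p) n.+1]_n n)).
  by apply: cvgB; [exact: cvg_cst|apply: cvgMr; rewrite cvg_shiftS; exact: px].
apply/funext => n /=; rewrite pierce_series_shift mulrC divfK//.
by rewrite subKr.
Qed.

Lemma pierce_expansion_weak_bounds x p : pierce_expansion x p ->
  0 <= x <= (p 0%N)%:R^-1.
Proof.
move=> [p0 pS px]; rewrite -(cvg_lim _ px)//; apply/andP; split.
- apply: limr_ge; first by apply/cvg_ex; exists x.
  by near=> n; have /andP[] := pierce_series_bounds p n p0 pS.
- apply: limr_le; first by apply/cvg_ex; exists x.
  by near=> n; have /andP[] := pierce_series_bounds p n p0 pS.
Unshelve. all: by end_near. Qed.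

(** Every expansion has a positive value: its tail x' = 1 - p_1 x satisfies
    x' <= 1 / p_2 < 1 by the weak bounds. Applied to the tail x' of x this gives
    x < 1 / p_1, and applied to the tail of x' it gives
    x' < 1 / p_2 <= 1 / (p_1 + 1), which means that x > 1 / (p_1 + 1). *)
Lemma pierce_expansion_bounds x p : pierce_expansion x p ->
  (p 0%N).+1%:R^-1 < x < (p 0%N)%:R^-1.
Proof.
have pos y q : pierce_expansion y q -> 0 < y.
  move=> yq; have [q0 qS _] := yq.
  have /andP[_ +] := pierce_expansion_weak_bounds _ _ (pierce_expansion_tail _ _ yq).
  have q1 : (2 <= shift 1 q 0%N)%N by have := shift1_gt _ qS; lia.
  have : (shift 1 q 0%N)%:R^-1 < 1 :> R by rewrite invf_lt1 ?ltr1n ?ltr0n// ltnW.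
  move=> /le_lt_trans /[apply]; rewrite ltrBlDr ltrDl pmulr_rgt0//.
  by rewrite ltr0n.
move=> xp; have [p0 pS _] := xp.
have p0' : 0 < (p 0%N)%:R :> R by rewrite ltr0n.
have tl := pierce_expansion_tail _ _ xp.
have t0 := pos _ _ tl.
apply/andP; split; last first.
  by rewrite -[ltRHS]mul1r ltr_pdivlMr// mulrC; rewrite subr_gt0 in t0.
have tt0 := pos _ _ (pierce_expansion_tail _ _ tl).
have p1 : ((p 0%N).+1 <= shift 1 p 0%N)%N by exact: shift1_gt.
move: tt0; rewrite subr_gt0 => tt0.
have h : (p 0%N).+1%:R * (1 - (p 0%N)%:R * x) < 1.
  by rewrite (le_lt_trans _ tt0)// ler_wpM2r ?(ltW t0)// ler_nat.
have q0 : 0 < (p 0%N).+1%:R :> R by rewrite ltr0n.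
rewrite -[ltLHS]mul1r ltr_pdivrMr//; move: h; rewrite -natr1; nra.
Qed.

Lemma pierce_expansion_gt0 x p : pierce_expansion x p -> forall k, (0 < p k)%N.
Proof.
by move=> [p0 pS _] k; exact: leq_ltn_trans (pierce_digit_lb _ p0 pS k).
Qed.

(** The strict bounds determine the first digit, and the first digit determines
    the tail. *)
Lemma pierce_expansion_unique x p q :
  pierce_expansion x p -> pierce_expansion x q -> p = q.
Proof.
have first_digit y p' q' : pierce_expansion y p' -> pierce_expansion y q' ->
    p' 0%N = q' 0%N.
  move=> yp yq; have /andP[lp up] := pierce_expansion_bounds _ _ yp.
  have /andP[lq uq] := pierce_expansion_bounds _ _ yq.
  have p0 := pierce_expansion_gt0 _ _ yp 0%N.
  have q0 := pierce_expansion_gt0 _ _ yq 0%N.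
  have := lt_trans lp uq; rewrite ltf_pV2 ?posrE ?ltr0n// ltr_nat => qp.
  have := lt_trans lq up; rewrite ltf_pV2 ?posrE ?ltr0n// ltr_nat => pq.
  lia.
move=> xp xq; apply/funext => n; elim: n x p q xp xq => [|n IH] x p q xp xq.
  exact: first_digit xp xq.
have xq' := pierce_expansion_tail _ _ xq; rewrite -(first_digit _ _ _ xp xq) in xq'.
exact: IH (pierce_expansion_tail _ _ xp) xq'.
Qed.

(** Infinite descent on the numerator: if x = m / d, then the tail
    1 - p_1 x = (d - p_1 m) / d is positive, and smaller than x because
    x' < 1 / p_2 <= 1 / (p_1 + 1) < x. *)
Lemma pierce_expansion_irrational x p : pierce_expansion x p -> irrational x.
Proof.
move=> xp [r _ rx].
have descent m : forall y q, pierce_expansion y q ->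
    forall d, (0 < d)%N -> y * d%:R <> m%:R.
  elim/ltn_ind: m => m IH y q yq d d0 ym.
  have [q0 _ _] := yq.
  have /andP[l u] := pierce_expansion_bounds _ _ yq.
  have t := pierce_expansion_tail _ _ yq.
  have /andP[lt ut] := pierce_expansion_bounds _ _ t.
  have d0' : 0 < d%:R :> R by rewrite ltr0n.
  have qm : (q 0%N * m < d)%N.
    rewrite -(ltr_nat R) natrM -ym mulrA gtr_pMl// -ltr_pdivlMl ?ltr0n//.
    by rewrite mulr1.
  have tm : (1 - (q 0%N)%:R * y) * d%:R = (d - q 0%N * m)%:R.
    by rewrite natrB ?(ltnW qm)// natrM -ym; ring.
  have lm : (d - q 0%N * m < m)%N.
    rewrite -(ltr_nat R) -tm -ym ltr_pM2r// (lt_le_trans ut)// (le_trans _ (ltW l))//.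
    have [_ qS _] := yq; have q1 := shift1_gt _ qS.
    by rewrite lef_pV2 ?posrE ?ltr0n ?ler_nat//; lia.
  exact: (IH _ lm _ _ t d d0 tm).
have /andP[l _] := pierce_expansion_bounds _ _ xp.
have x0 : 0 < x by rewrite (lt_trans _ l)// invr_gt0 ltr0n.
have r0 : 0 < r by rewrite -(ltr0q R) rx.
apply: (descent `|numq r|%N x p xp `|denq r|%N).
  by rewrite absz_gt0 denq_eq0.
have n0 : 0 <= numq r by rewrite numq_ge0 ltW.
by rewrite !pmulrn !gez0_abs// -rx /ratr divfK// intr_eq0 denq_eq0.
Qed.

(** The denominators grow at least like 2^k, so a geometric series dominates. *)
Lemma pierce_expansion_exists p : (1 <= p 0%N)%N ->
  (forall k, (p k + 1 <= p k.+1)%N) -> exists x : R, pierce_expansion x p.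
Proof.
move=> p0 pS.
suff /cvg_ex[x xp] : cvgn (series (@pierce_term R p)) by exists x; split.
apply: normed_cvg.
apply: (@series_le_cvg _ _ (geometric 1 (2^-1))).
- by move=> n; exact: normr_ge0.
- by move=> n; rewrite /geometric /= mul1r exprn_ge0// invr_ge0 ler0n.
- move=> n; rewrite /geometric /= mul1r /pierce_term normrM normrX normrN1 expr1n mul1r.
  rewrite big_ord_recl exprVn normfV ger0_norm; last first.
    by rewrite mulr_ge0// prodr_ge0.
  rewrite lef_pV2 ?posrE ?exprn_gt0//; last first.
    rewrite mulr_gt0 ?ltr0n// prodr_gt0// => i _.
    by rewrite ltr0n; exact: leq_ltn_trans (pierce_digit_lb _ p0 pS _).
  rewrite -[leLHS]mul1r ler_pM// ?exprn_ge0// ?ler1n//.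
  rewrite -[X in _ ^+ X]card_ord -prodr_const; apply: ler_prod => i _.
  rewrite ler0n ler_nat /=; have := pierce_digit_lb _ p0 pS (bump 0 i).
  by rewrite /bump; lia.
- by apply: is_cvg_geometric_series; rewrite ger0_norm ?invf_lt1 ?ltr1n// invr_ge0.
Qed.

End Bounds.

(** * The two notations and their digits *)

Section Digits.
Context {R : realType}.
Implicit Types (x y : R) (p q : nat -> nat) (phi : nat -> R).

Lemma pierce_digitE x p : pierce_expansion x p ->
  forall n, pierce_digit n x = p n.-1.
Proof.
move=> xp n; rewrite /pierce_digit (xget_unique _ xp)// => q xq.
exact: pierce_expansion_unique xq xp.
Qed.

Lemma pierce_perron_expansionP x p :
  pierce_perron_expansion x (fun k => (p k).+1) <-> pierce_expansion x p.
Proof.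
rewrite /pierce_perron_expansion /pierce_expansion.
have -> : (fun k => (-1) ^+ k / \prod_(i < k.+1) ((p i).+1%:R - 1)) =
          @pierce_term R p.
  apply/funext => k; rewrite /pierce_term; congr (_ / _).
  by apply: eq_bigr => i _; rewrite -natr1 addrK.
by split=> -[p0 pS px]; split=> // k; have := pS k; lia.
Qed.

Lemma pierce_perron_expansion_pred x q : pierce_perron_expansion x q ->
  exists2 p, pierce_expansion x p & q = fun k => (p k).+1.
Proof.
move=> xq; have [q0 qS _] := xq.
have qgt0 k : (0 < q k)%N by elim: k => [|k IH]; [lia|have := qS k; lia].
have e : q = fun k => (q k).-1.+1 by apply/funext => k; rewrite prednK.
by exists (fun k => (q k).-1) => //; apply/pierce_perron_expansionP; rewrite -e.
Qed.

Lemma pierce_perron_digitE x p : pierce_expansion x p ->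
  forall n, pierce_perron_digit n x = (p n.-1).+1.
Proof.
move=> xp n; rewrite /pierce_perron_digit.
have xp' : [set q | pierce_perron_expansion x q] (fun k => (p k).+1).
  exact/pierce_perron_expansionP.
rewrite (xget_unique _ xp')// => q /pierce_perron_expansion_pred[p' xp2 ->].
by rewrite (pierce_expansion_unique _ _ _ xp xp2).
Qed.

(** As phi tends to infinity, bounded errors in the logarithms do not affect the
    limit. This serves both to compare the two notations and to check that the
    Cantor subset of the lower bound lies in the set under study. *)
Lemma cvg_bounded_perturbation (a b phi : nat -> R) (C : R) :
  (forall n, `|a n - b n| <= C) -> phi n @[n --> \oo] --> +oo ->
  b n / phi n @[n --> \oo] --> (1 : R) -> a n / phi n @[n --> \oo] --> (1 : R).
Proof.
move=> abC phioo b1.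
have -> : (fun n => a n / phi n) = (fun n => b n / phi n + (a n - b n) / phi n).
  by apply/funext => n; rewrite -mulrDl addrC subrK.
rewrite -[X in _ --> X]addr0; apply: cvgD => //.
apply/cvgrPdist_le => /= e e0; near=> n.
have p0 : 0 < phi n by near: n; exact: cvgry_gt.
rewrite sub0r normrN normrM normfV (gtr0_norm p0) ler_pdivrMr//.
rewrite (le_trans (abC n))// -ler_pdivrMl//.
by near: n; exact: cvgry_ge.
Unshelve. all: by end_near. Qed.

(** The set under study, in terms of an expansion rather than of the digits of
    x. The index of p starts at 0, so the quotient p_(n+2) / p_(n+1) of
    consecutive digits is compared with phi (n + 2). *)
Definition pierce_growth (phi : nat -> R) : set R :=
  [set x | exists2 p, pierce_expansion x p &
    ln ((p n.+1)%:R / (p n)%:R) / phi n.+2 @[n --> \oo] --> (1 : R)].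

Lemma digit_ratio_cvg_shift phi p :
  (ln ((p n.-1)%:R / (p n.-1.-1)%:R) / phi n @[n --> \oo] --> (1 : R)) =
  (ln ((p n.+1)%:R / (p n)%:R) / phi n.+2 @[n --> \oo] --> (1 : R)).
Proof.
pose u n : R := ln ((p n.-1)%:R / (p n.-1.-1)%:R) / phi n.
by rewrite -(cvg_shiftS u) -(cvg_shiftS (fun n => u n.+1)).
Qed.

Lemma pierce_growth_itv phi x : pierce_growth phi x -> 0 < x < 1 /\ irrational x.
Proof.
move=> [p xp _]; split; last exact: pierce_expansion_irrational xp.
have /andP[l u] := pierce_expansion_bounds _ _ xp; have [p0 _ _] := xp.
rewrite (lt_trans _ l) ?invr_gt0 ?ltr0n//= (lt_le_trans u)//.
by rewrite invf_le1 ?ler1n ?ltr0n.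
Qed.

(** For a point without an expansion all digits are 0 by default; such a point
    must be seen not to belong to the sets of the theorem. *)
Lemma no_expansion_cvg (phi : nat -> R) :
  ~ (ln ((0%N%:R : R) / (0%N%:R : R)) / phi n @[n --> \oo] --> (1 : R)).
Proof.
under eq_fun do rewrite mul0r (ln0 (lexx 0)) mul0r.
move=> /cvg_lim; rewrite lim_cst// => /(_ (@norm_hausdorff _ _)) /eqP.
by rewrite eq_sym oner_eq0.
Qed.

Lemma pierce_digit_cvgE phi x p : pierce_expansion x p ->
  (ln ((pierce_digit n x)%:R / (pierce_digit n.-1 x)%:R) / phi n
    @[n --> \oo] --> (1 : R)) =
  (ln ((p n.+1)%:R / (p n)%:R) / phi n.+2 @[n --> \oo] --> (1 : R)).
Proof.
move=> xp; rewrite -digit_ratio_cvg_shift.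
by under eq_fun do rewrite !(pierce_digitE _ _ xp).
Qed.

Lemma pierce_perron_digit_cvgE phi x p : pierce_expansion x p ->
  (ln ((pierce_perron_digit n x)%:R / (pierce_perron_digit n.-1 x)%:R) / phi n
    @[n --> \oo] --> (1 : R)) =
  (ln ((p n.+1).+1%:R / (p n).+1%:R) / phi n.+2 @[n --> \oo] --> (1 : R)).
Proof.
move=> xp; rewrite -(digit_ratio_cvg_shift phi (fun k => (p k).+1)).
by under eq_fun do rewrite !(pierce_perron_digitE _ _ xp).
Qed.

Lemma traditional_setE phi :
  [set x : R | [/\ 0 < x < 1, irrational x &
    ln ((pierce_digit n x)%:R / (pierce_digit n.-1 x)%:R)
      / phi n @[n --> \oo] --> (1 : R)]] = pierce_growth phi.
Proof.
apply/seteqP; split=> x /=.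
  move=> [_ _].
  have [[p xp]|nxp] := pselect (exists p, pierce_expansion x p); last first.
    have nq q : ~ [set q | pierce_expansion x q] q by move=> xq; apply: nxp; exists q.
    under eq_fun do rewrite /pierce_digit xgetPN//.
    by move=> /no_expansion_cvg.
  by rewrite (pierce_digit_cvgE _ _ _ xp); exists p.
move=> xE; have [x01 xirr] := pierce_growth_itv _ _ xE.
split; [exact: x01|exact: xirr|].
by case: xE => p xp; rewrite (pierce_digit_cvgE _ _ _ xp).
Qed.

Lemma ln_succ_ratio (m n : nat) : (0 < m)%N -> (0 < n)%N ->
  `|ln (m.+1%:R / n.+1%:R) - ln (m%:R / n%:R)| <= ln 2 :> R.
Proof.
have h k : (0 < k)%N -> 0 <= ln (k.+1%:R : R) - ln k%:R <= ln 2.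
  move=> k0; rewrite subr_ge0 ler_ln ?posrE ?ltr0n// ler_nat leqnSn /=.
  rewrite lerBlDr -lnM ?posrE ?ltr0n// ler_ln ?posrE ?mulr_gt0 ?ltr0n//.
  by rewrite -natrM ler_nat; lia.
move=> m0 n0; rewrite !ln_div ?posrE ?ltr0n//.
have := h _ m0; have := h _ n0; rewrite ler_norml; lra.
Qed.

Lemma cvgry_shift2 phi : phi n @[n --> \oo] --> +oo ->
  phi n.+2 @[n --> \oo] --> +oo.
Proof.
apply: (@cvg_comp _ _ _ (fun n => n.+2) phi _ \oo).
rewrite (_ : (fun n => n.+2) = addn^~ 2%N); first exact: cvg_addnr.
by apply/funext => n; rewrite addn2.
Qed.

Lemma perron_setE phi : phi n @[n --> \oo] --> +oo ->
  [set x : R | [/\ 0 < x < 1, irrational x &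
    ln ((pierce_perron_digit n x)%:R / (pierce_perron_digit n.-1 x)%:R)
      / phi n @[n --> \oo] --> (1 : R)]] = pierce_growth phi.
Proof.
move=> phioo.
have phioo2 : phi n.+2 @[n --> \oo] --> +oo.
  exact: cvgry_shift2.
have E p x : pierce_expansion x p ->
    (ln ((p n.+1).+1%:R / (p n).+1%:R) / phi n.+2 @[n --> \oo] --> (1 : R)) <->
    (ln ((p n.+1)%:R / (p n)%:R) / phi n.+2 @[n --> \oo] --> (1 : R)).
  move=> /pierce_expansion_gt0 pgt0.
  split; apply: (cvg_bounded_perturbation _ _ _ (ln 2)) => // n.
    by rewrite distrC ln_succ_ratio.
  by rewrite ln_succ_ratio.
apply/seteqP; split=> x /=.
  move=> [_ _].
  have [[p xp]|nxp] := pselect (exists p, pierce_expansion x p); last first.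
    have nq q : ~ [set q | pierce_perron_expansion x q] q.
      by move=> /pierce_perron_expansion_pred[p xp _]; apply: nxp; exists p.
    under eq_fun do rewrite /pierce_perron_digit xgetPN//.
    by move=> /no_expansion_cvg.
  rewrite (pierce_perron_digit_cvgE _ _ _ xp) => h.
  by exists p => //; apply/(E _ _ xp).
move=> xE; have [x01 xirr] := pierce_growth_itv _ _ xE.
split; [exact: x01|exact: xirr|].
by case: xE => p xp h; rewrite (pierce_perron_digit_cvgE _ _ _ xp); apply/(E _ _ xp).
Qed.

End Digits.

(** * Distances between points with a common prefix of digits *)

Section Distances.
Context {R : realType}.
Implicit Types (x y : R) (p q : nat -> nat).

Lemma pierce_expansion_dist n x y p q :
  pierce_expansion x p -> pierce_expansion y q ->
  (forall i, (i < n)%N -> p i = q i) ->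
  exists x' y' : R, [/\ pierce_expansion x' (shift n p),
    pierce_expansion y' (shift n q) &
    `|x - y| = `|x' - y'| / \prod_(i < n) (p i)%:R].
Proof.
elim: n x y p q => [|n IH] x y p q xp yq pq.
  by exists x, y; split; rewrite // big_ord0 divr1.
have [|x' [y' [xp' yq' e]]] := IH _ _ _ _ (pierce_expansion_tail _ _ xp)
  (pierce_expansion_tail _ _ yq).
  by move=> i i_n; exact: pq.
exists x', y'; split=> //.
rewrite big_ord_recl invfM mulrCA -/(`|x' - y'| / _) -e -(pq 0%N)//.
have [p0 _ _] := xp; have p0' : 0 < (p 0%N)%:R :> R by rewrite ltr0n.
rewrite (_ : 1 - _ - _ = (p 0%N)%:R * (y - x)); last by ring.
by rewrite normrM (gtr0_norm p0') mulKf ?gt_eqF// distrC.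
Qed.

(** The tails of x and y after n digits both lie between 0 and 1 / c. *)
Lemma pierce_cylinder_dist n x y p q (c : R) :
  pierce_expansion x p -> pierce_expansion y q ->
  (forall i, (i < n)%N -> p i = q i) -> c <= (p n)%:R -> c <= (q n)%:R -> 0 < c ->
  `|x - y| <= c^-1 / \prod_(i < n) (p i)%:R.
Proof.
move=> xp yq pq cp cq c0.
have [x' [y' [xp' yq' ->]]] := pierce_expansion_dist _ _ _ _ _ xp yq pq.
rewrite ler_wpM2r ?invr_ge0 ?prodr_ge0//.
have /andP[lx ux] := pierce_expansion_bounds _ _ xp'.
have /andP[ly uy] := pierce_expansion_bounds _ _ yq'.
have x0 : 0 < x' by rewrite (lt_trans _ lx)// invr_gt0 ltr0n.
have y0 : 0 < y' by rewrite (lt_trans _ ly)// invr_gt0 ltr0n.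
have hx : x' <= c^-1.
  rewrite (le_trans (ltW ux))// /shift addn0 lef_pV2 ?posrE//.
  exact: lt_le_trans cp.
have hy : y' <= c^-1.
  rewrite (le_trans (ltW uy))// /shift addn0 lef_pV2 ?posrE//.
  exact: lt_le_trans cq.
by rewrite ler_norml; lra.
Qed.

(** The tails x' and y' after n digits satisfy y' < 1 / q_n and
    x' > 1 / p_n - 1 / (p_n p_(n+1)). The assumption on the next digit p_(n+1)
    makes the last term at most half of the gap 1 / p_n - 1 / q_n. *)
Lemma pierce_digit_separation n x y p q :
  pierce_expansion x p -> pierce_expansion y q ->
  (forall i, (i < n)%N -> p i = q i) -> (p n < q n)%N ->
  (2 * (p n).+1 <= p n.+1)%N ->
  ((q n)%:R - (p n)%:R) / (2 * (p n)%:R * (q n)%:R) / \prod_(i < n) (p i)%:R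
    <= `|x - y|.
Proof.
move=> xp yq pq pqn p2.
have [x' [y' [xp' yq' ->]]] := pierce_expansion_dist _ _ _ _ _ xp yq pq.
rewrite ler_wpM2r ?invr_ge0 ?prodr_ge0// (le_trans _ (ler_norm _))//.
have /andP[_ uy] := pierce_expansion_bounds _ _ yq'.
have /andP[_ ux] := pierce_expansion_bounds _ _ (pierce_expansion_tail _ _ xp').
rewrite /shift addn0 in uy; rewrite /shift addn0 addn1 in ux.
have a1 : 1 <= (p n)%:R :> R by rewrite ler1n (pierce_expansion_gt0 _ _ xp).
set a : R := (p n)%:R in a1 ux *; set b : R := (q n)%:R in uy *.
have ab : a + 1 <= b by rewrite natr1 ler_nat.
have b0 : 0 < b by lra.
have a0' : 0 < a by lra.
have c2 : 2 * (a + 1) <= (p n.+1)%:R by rewrite natr1 -natrM ler_nat.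
have h : 1 - a * x' < (2 * (a + 1))^-1.
  by rewrite (lt_le_trans ux)// lef_pV2 ?posrE//; lra.
have e1 : (2 * (a + 1))^-1 <= (b - a) / (2 * b).
  by rewrite ler_pdivlMr ?mulr_gt0// mulrC ler_pdivrMr; nra.
have : a^-1 - (b - a) / (2 * a * b) <= x'.
  rewrite (_ : _ - _ = a^-1 * (1 - (b - a) / (2 * b))); last first.
    by field; rewrite !gt_eqF.
  by rewrite ler_pdivrMl//; lra.
have : (b - a) / (2 * a * b) * 2 = a^-1 - b^-1 by field; rewrite !gt_eqF.
lra.
Qed.

End Distances.

(** * Hausdorff measures on the real line *)

Section Hausdorff.
Context {R : realType}.
Implicit Types (s delta r : R) (A U : set R).
Local Open Scope ereal_scope.

Lemma diameter_ge0 U : 0 <= diameter U.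
Proof. by rewrite /diameter le_max/= lexx. Qed.

Lemma le_diameter U (x y : R) : U x -> U y -> `|x - y|%:E <= diameter U.
Proof.
move=> Ux Uy; rewrite /diameter le_max; apply/orP; right.
by apply: ereal_sup_ubound; exists (x, y).
Qed.

Lemma diameter_le U r : (0 <= r)%R ->
  (forall x y, U x -> U y -> `|x - y| <= r)%R -> diameter U <= r%:E.
Proof.
move=> r0 Ur; rewrite /diameter ge_max lee_fin r0/=.
by apply: ge_ereal_sup => _ [[x y] [/= Ux Uy] <-]; rewrite lee_fin Ur.
Qed.

Lemma diameter_pow_set0 s : diameter_pow s set0 = 0.
Proof. by rewrite /diameter_pow; destruct (pselect _). Qed.

Lemma diameter_pow_neq0 s U : U <> set0 -> diameter_pow s U = diameter U `^ s.
Proof. by rewrite /diameter_pow; destruct (pselect _). Qed.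

Lemma diameter_pow_ge0 s U : 0 <= diameter_pow s U.
Proof.
have [->|U0] := pselect (U = set0); first by rewrite diameter_pow_set0.
by rewrite diameter_pow_neq0// poweR_ge0.
Qed.

Lemma diameter_set0 : diameter (@set0 R) = 0.
Proof. by apply/eqP; rewrite eq_le diameter_ge0 andbT; exact: diameter_le. Qed.

Lemma diameter_pow_le s U r : (0 <= s)%R -> diameter U <= r%:E ->
  diameter_pow s U <= (r `^ s)%:E.
Proof.
move=> s0 Ur.
have [->|U0] := pselect (U = set0).
  by rewrite diameter_pow_set0 lee_fin powR_ge0.
rewrite diameter_pow_neq0// -poweR_EFin; apply: gt0_ler_poweR => //.
- by rewrite in_itv /= diameter_ge0 leey.
- by rewrite in_itv /= (le_trans (diameter_ge0 U) Ur) leey.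
Qed.

Lemma hausdorff_premeasure_ge0 s delta A : 0 <= hausdorff_premeasure s delta A.
Proof.
apply: le_ereal_inf_tmp => _ [F _ <-].
by apply: nneseries_ge0 => n _ _; exact: diameter_pow_ge0.
Qed.

Lemma hausdorff_measure_eq0 s A :
  (forall delta, (0 < delta)%R -> hausdorff_premeasure s delta A <= 0) ->
  hausdorff_measure s A = 0.
Proof.
move=> h; apply/eqP; rewrite eq_le; apply/andP; split.
  by apply: ge_ereal_sup => _ [delta d0 <-]; exact: h.
apply: (le_trans (hausdorff_premeasure_ge0 s 1 A)).
by apply: ereal_sup_ubound; exists 1%R => //=; exact: ltr01.
Qed.

Lemma hausdorff_premeasure_finite_cover (T : eqType) s delta A (L : seq T)
    (F : T -> set R) r :
  (0 <= s)%R -> (0 <= r <= delta)%R ->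
  (forall x, A x -> exists2 w, w \in L & F w x) ->
  (forall w, w \in L -> diameter (F w) <= r%:E) ->
  hausdorff_premeasure s delta A <= ((size L)%:R * r `^ s)%:E.
Proof.
move=> s0 /andP[r0 rd] AL Lr.
pose G i := nth set0 (map F L) i.
have Gr k : diameter (G k) <= r%:E.
  have [kL|kL] := ltnP k (size (map F L)); last first.
    by rewrite /G nth_default// diameter_set0 lee_fin.
  have /mapP[w wL ->] : G k \in map F L by exact: mem_nth.
  exact: Lr.
apply: ge_ereal_inf; exists (\sum_(0 <= k <oo) diameter_pow s (G k)).
  exists G => //; split=> [x /AL[w wL Fwx]|k]; last first.
    by rewrite (le_trans (Gr k))// lee_fin.
  exists (index w L) => //=.
  by rewrite /G (nth_map w) ?index_mem// nth_index.
rewrite (nneseries_split 0%N (size L)); last by move=> *; exact: diameter_pow_ge0.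
rewrite add0n (@eseries0 _ _ (size L)) => [|k Lk _]; last first.
  by rewrite /G nth_default ?size_map// diameter_pow_set0.
rewrite adde0.
apply: (@le_trans _ _ (\sum_(0 <= k < size L) (r `^ s)%:E)).
  by apply: lee_sum => k _; exact: diameter_pow_le.
by rewrite sumEFin sumr_const_nat subn0 mulr_natl.
Qed.

(** Choose for the n-th set a cover of cost at most e / 2^(n+1), and enumerate
    the union of these countable covers. *)
Lemma hausdorff_measure_bigcup_null s (A : nat -> set R) :
  (forall n, hausdorff_measure s (A n) = 0) ->
  hausdorff_measure s (\bigcup_n A n) = 0.
Proof.
move=> A0; apply: hausdorff_measure_eq0 => delta d0.
apply/lee_addgt0Pr => e e0; rewrite add0e.
pose P n (F : nat -> set R) := [/\ A n `<=` \bigcup_k F k,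
  forall k, diameter (F k) <= delta%:E &
  \sum_(0 <= k <oo) diameter_pow s (F k) <= (e / (2 ^ n.+1)%:R)%:E].
have /choice[F FP] : forall n, exists F, P n F.
  move=> n.
  have Hn : hausdorff_premeasure s delta (A n) = 0.
    apply/eqP; rewrite eq_le hausdorff_premeasure_ge0 andbT -(A0 n).
    by apply: ereal_sup_ubound; exists delta.
  have en : (0 < e / (2 ^ n.+1)%:R)%R by rewrite divr_gt0// ltr0n expn_gt0.
  have [|_ [F [AF Fd] <-]] :=
    @lb_ereal_inf_adherent R [set \sum_(0 <= k <oo) diameter_pow s (F k) |
    F in [set F : nat -> set R | A n `<=` \bigcup_k F k /\
                                 forall k, diameter (F k) <= delta%:E]] _ en.
    by rewrite -/(hausdorff_premeasure s delta (A n)) Hn.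
  rewrite -/(hausdorff_premeasure s delta (A n)) Hn add0e => /ltW Fe.
  by exists F.
have /card_esym/ppcard_eqP[f] := card_nat2.
pose a (p : nat * nat) := diameter_pow s (F p.1 p.2).
have a0 p : 0 <= a p by exact: diameter_pow_ge0.
apply: ge_ereal_inf; exists (\sum_(0 <= k <oo) a (f k)).
  exists (fun k => F (f k).1 (f k).2) => //; split.
    move=> x [n _ Anx]; have [AF _ _] := FP n; have [k _ Fx] := AF _ Anx.
    by exists (f^-1%FUN (n, k)) => //=; rewrite invK ?inE.
  by move=> k; have [_ + _] := FP (f k).1; exact.
rewrite nneseries_esumT// -(reindex_esum setT setT f)//.
rewrite (_ : setT = [set: nat] `*`` (fun=> [set: nat])); last first.
  by apply/seteqP; split.
rewrite -(@esum_esum _ _ _ _ _ (fun i j => a (i, j)))//.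
rewrite -nneseries_esumT => [|n]; last by apply: esum_ge0.
have := @epsilon_trick R (fun=> 0) e xpredT (fun=> lexx _) (ltW e0).
rewrite (eseries0 (fun _ _ _ => erefl)) add0e; apply: le_trans.
apply: lee_nneseries => n _; first by move=> _; exact: esum_ge0.
rewrite -nneseries_esumT// add0e; by have [] := FP n.
Qed.

Lemma hausdorff_measure_sub_null s A B : A `<=` B ->
  hausdorff_measure s B = 0 -> hausdorff_measure s A = 0.
Proof.
move=> AB B0; apply: hausdorff_measure_eq0 => delta d0.
rewrite -B0; apply: (@le_trans _ _ (hausdorff_premeasure s delta B)); last first.
  by apply: ereal_sup_ubound; exists delta.
apply: le_ereal_inf_tmp => _ [F [BF Fd] <-]; apply: ereal_inf_lbound.
by exists F => //; split=> //; exact: subset_trans BF.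
Qed.

(** A form of the mass distribution principle in which the map g stands for a
    measure on A: each set F k of a cover of A pulls back along g into an
    interval of length 2 C diam(F k)^s, and the intervals cover [0, 1). *)
Lemma hausdorff_measure_holder_neq0 s A (g : R -> R) (C : R) :
  (0 <= s)%R -> (0 < C)%R ->
  (forall t, 0 <= t < 1 -> A (g t))%R ->
  (forall t u, 0 <= t < 1 -> 0 <= u < 1 -> `|t - u| <= C * `|g t - g u| `^ s)%R ->
  hausdorff_measure s A <> 0.
Proof.
move=> s0 C0 gA gC A0.
have Ci0 : (0 < (2 * C)^-1)%R by rewrite invr_gt0 mulr_gt0.
suff : (2 * C)^-1%:E <= hausdorff_measure s A.
  by rewrite A0 lee_fin leNgt Ci0.
apply: (@le_trans _ _ (hausdorff_premeasure s 1 A)); last first.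
  by apply: ereal_sup_ubound; exists 1%R => //=; exact: ltr01.
apply: le_ereal_inf_tmp => _ [F [AF Fd] <-].
have Ffin k : diameter (F k) \is a fin_num.
  by rewrite ge0_fin_numE ?diameter_ge0// (le_lt_trans (Fd k))// ltry.
pose rad k := (C * fine (diameter (F k)) `^ s)%R.
have rad0 k : (0 <= rad k)%R by rewrite mulr_ge0 ?powR_ge0// ltW.
have /choice[I IP] : forall k, exists I : set R, [/\ measurable I,
    forall t, (0 <= t < 1)%R -> F k (g t) -> I t &
    lebesgue_measure I <= (2 * C)%:E * diameter_pow s (F k)].
  move=> k.
  have [[t [t01 Ft]]|nt] := pselect (exists t, (0 <= t < 1)%R /\ F k (g t)); last first.
    exists set0; split=> //; last first.
      by rewrite measure0 mule_ge0 ?diameter_pow_ge0// lee_fin mulr_ge0// ltW.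
    by move=> t t01 Ft; exfalso; apply: nt; exists t.
  exists `[(t - rad k)%R, (t + rad k)%R]%classic; split.
  - exact: measurable_itv.
  - move=> u u01 Fu; rewrite /= in_itv/=.
    have h : (`|t - u| <= rad k)%R.
      rewrite (le_trans (gC _ _ t01 u01))// /rad ler_pM2l//.
      apply: ge0_ler_powR; rewrite ?nnegrE ?fine_ge0 ?diameter_ge0//.
      by rewrite -lee_fin fineK// le_diameter.
    by move: h; rewrite ler_norml; lra.
  - rewrite lebesgue_measure_itv /= lte_fin.
    have -> : diameter_pow s (F k) = (fine (diameter (F k)) `^ s)%:E.
      rewrite diameter_pow_neq0 -?poweR_EFin ?fineK// => F0.
      by rewrite F0 in Ft.
    have e : (t + rad k - (t - rad k) = 2 * C * fine (diameter (F k)) `^ s)%R.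
      by rewrite /rad; ring.
    case: ifPn => _; first by rewrite -EFinB e EFinM.
    by rewrite -EFinM lee_fin -e; have := rad0 k; lra.
have : lebesgue_measure `[0%R, 1%R[%classic <=
    \sum_(0 <= k <oo) (2 * C)%:E * diameter_pow s (F k).
  apply: (@le_trans _ _ (\sum_(0 <= k <oo) lebesgue_measure (I k))).
    apply: measure_sigma_subadditive => [k||t].
    - by have [] := IP k.
    - exact: measurable_itv.
    - rewrite /= in_itv/= => t01; have [k _ Fk] := AF _ (gA _ t01).
      by exists k => //; have [_ + _] := IP k; apply.
  by apply: lee_nneseries => k // _; have [] := IP k.
rewrite nneseriesZl => [|k _]; last exact: diameter_pow_ge0.
rewrite lebesgue_measure_itv /= lte_fin ltr01 oppr0 adde0 => h.
rewrite -(@lee_pmul2l _ (2 * C)%:E)//; last by rewrite lte_fin mulr_gt0.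
by rewrite -EFinM mulfV ?gt_eqF ?mulr_gt0.
Qed.

Lemma hausdorff_dim_le s A : (0 <= s)%R -> hausdorff_measure s A = 0 ->
  hausdorff_dim A <= s%:E.
Proof. by move=> s0 sA; apply: ereal_inf_lbound; exists s. Qed.

End Hausdorff.

(** * Growth of the sums *)

Section Growth.
Context {R : realType}.
Implicit Types (u v f : nat -> R).

Lemma near_bounded_everywhere u c :
  (\forall n \near \oo, u n <= c) -> exists C, forall n, u n <= C.
Proof.
move=> [N _ h]; exists (`|c| + \sum_(i < N) `|u i|) => n.
have [Nn|nN] := leqP N n.
  by rewrite (le_trans (h _ Nn))// (le_trans (ler_norm _))// lerDl sumr_ge0.
rewrite (bigD1 (Ordinal nN))//= addrCA (le_trans (ler_norm _))// lerDl.
by rewrite addr_ge0// sumr_ge0.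
Qed.

(** A discrete mean value argument: comparing the increments compares the
    sequences up to a constant. All asymptotics of sums below come from it. *)
Lemma le_up_to_const u v :
  (\forall n \near \oo, u n.+1 - u n <= v n.+1 - v n) ->
  exists C, forall n, u n <= v n + C.
Proof.
move=> [N _ h].
suff /near_bounded_everywhere[C uvC] : \forall n \near \oo, u n - v n <= u N - v N.
  by exists C => n; rewrite -lerBlDl.
exists N => //= n Nn.
have {Nn}[m ->] : exists m, n = (N + m)%N by exists (n - N)%N; rewrite subnKC.
elim: m => [|m IH]; first by rewrite addn0.
have := h (N + m)%N (leq_addr _ _); rewrite addnS; lra.
Qed.

Definition psum f n : R := \sum_(i < n) f i.

(** The denominator in the definition of theta, see psum2E. *)
Definition psum2 f n : R := \sum_(j < n) psum f j.+1.

Lemma psumS f n : psum f n.+1 = psum f n + f n.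
Proof. by rewrite /psum big_ord_recr. Qed.

Lemma psum2S f n : psum2 f n.+1 = psum2 f n + psum f n.+1.
Proof. by rewrite /psum2 big_ord_recr. Qed.

Lemma psum_ge0 f n : (forall k, 0 < f k) -> 0 <= psum f n.
Proof. by move=> f0; apply: sumr_ge0 => i _; exact: ltW. Qed.

Lemma psum2_ge0 f n : (forall k, 0 < f k) -> 0 <= psum2 f n.
Proof. by move=> f0; apply: sumr_ge0 => i _; exact: psum_ge0. Qed.

Lemma near_ge_nat (c : R) : \forall n \near \oo, c <= n%:R.
Proof.
exists (Num.truncn c).+1 => // n tn; apply: (le_trans (ltW (truncnS_gt c))).
by rewrite ler_nat.
Qed.

Lemma psum_superlinear f A : f n @[n --> \oo] --> +oo ->
  \forall n \near \oo, A * n%:R <= psum f n.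
Proof.
move=> foo.
have [C fC] : exists C, forall n, (A + 1) * n%:R <= psum f n + C.
  apply: le_up_to_const; near=> n.
  rewrite psumS addrAC subrr add0r -mulrBr -natrB// subSnn mulr1.
  by near: n; exact: cvgry_ge.
near=> n; have := fC n; have : C <= n%:R by near: n; exact: near_ge_nat.
lra.
Unshelve. all: by end_near. Qed.

Lemma psum2_superlinear f A : f n @[n --> \oo] --> +oo ->
  \forall n \near \oo, A * n.+1%:R <= psum2 f n.
Proof.
move=> foo.
have [C fC] : exists C, forall n, (A + 1) * n.+1%:R <= psum2 f n + C.
  apply: le_up_to_const.
  have [N _ h] := psum_superlinear f `|A + 1| foo.
  exists N => //= n Nn; have := h n.+1 (leqW Nn).
  rewrite psum2S addrAC subrr add0r -mulrBr -natrB// subSnn mulr1.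
  by apply: le_trans; rewrite (le_trans (ler_norm _))// ler_peMr// ler1n.
near=> n; have := fC n; have : C <= n%:R by near: n; exact: near_ge_nat.
by rewrite -natr1; lra.
Unshelve. all: by end_near. Qed.

Lemma psumE (phi : nat -> R) n :
  \sum_(1 <= k < n.+1) phi k = psum (fun k => phi k.+1) n.
Proof. by rewrite big_add1 /= big_mkord. Qed.

Lemma psum2E (phi : nat -> R) n :
  \sum_(1 <= k < n.+1) (n - k + 1)%N%:R * phi k = psum2 (fun k => phi k.+1) n.
Proof.
elim: n => [|n IH]; first by rewrite big_geq// /psum2 big_ord0.
rewrite psum2S -IH -psumE !(@big_nat_recr _ _ _ n.+1 1%N)//=.
rewrite subnn add0n mul1r addrA -big_split /=; congr (_ + _).
apply: eq_big_nat => k /andP[k1 kn].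
by rewrite subSn// addSn -natr1 mulrDl mul1r.
Qed.

Lemma limn_esup_gt_frequently (u : nat -> \bar R) (t : \bar R) :
  (t < limn_esup u)%E -> forall N, exists2 n, (N <= n)%N & (t < u n)%E.
Proof.
move=> tu N.
have : (t < ereal_sup [set u n | n in [set n | (N <= n)%N]])%E.
  apply: (lt_le_trans tu); apply: ereal_inf_lbound => /=.
  by exists [set n | (N <= n)%N] => //; exists N.
by move=> /ereal_sup_gt[_ [n Nn <-] tun]; exists n.
Qed.

Lemma limn_esup_lt_near (u : nat -> \bar R) (t : \bar R) :
  (limn_esup u < t)%E -> \forall n \near \oo, (u n < t)%E.
Proof.
move=> /ereal_inf_lt[_ [V Voo <-] Vt].
apply: filterS Voo => n Vn; apply: le_lt_trans Vt.
by apply: ereal_sup_ubound; exists n.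
Qed.

End Growth.

(** * Upper bound: covering by cylinders *)

Section Upper.
Context {R : realType}.
Variable f : nat -> R.
Hypothesis f_gt0 : forall k, 0 < f k.
Hypothesis f_cvg : f n @[n --> \oo] --> +oo.

(** The additive constant K absorbs what happens before the asymptotic regime,
    so that the bounds on the digits hold for all n and uniformly on the class. *)
Definition growth_class (eps K : R) : set R :=
  [set x | exists2 p, pierce_expansion x p &
    forall n, `|ln (p n)%:R - psum f n.+1| <= K + eps * psum f n.+1].

Lemma growth_class_cover (phi : nat -> R) eps : 0 < eps ->
  (forall n, phi n.+2 = f n.+1) ->
  pierce_growth phi `<=` \bigcup_K growth_class eps K%:R.
Proof.
move=> eps0 phif x [p xp lim1].
have pgt0 k : 0 < (p k)%:R :> R by rewrite ltr0n (pierce_expansion_gt0 _ _ xp).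
have step : \forall n \near \oo,
    `|ln (p n.+1)%:R - ln (p n)%:R - f n.+1| <= eps * f n.+1.
  have /cvgrPdist_le/(_ _ eps0)[N _ h] := lim1.
  exists N => // n Nn; have := h n Nn.
  rewrite /= phif ln_div ?posrE//.
  rewrite distrC -(ler_pM2r (f_gt0 n.+1)) -{2}(gtr0_norm (f_gt0 n.+1)) -normrM.
  by rewrite mulrBl mul1r divfK// gt_eqF.
have [C1 h1] : exists C, forall n,
    ln (p n)%:R <= (1 + eps) * psum f n.+1 + C.
  apply: le_up_to_const; near=> n.
  have : `|ln (p n.+1)%:R - ln (p n)%:R - f n.+1| <= eps * f n.+1 by near: n.
  by rewrite ler_norml (psumS f n.+1); lra.
have [C2 h2] : exists C, forall n,
    (1 - eps) * psum f n.+1 <= ln (p n)%:R + C.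
  apply: le_up_to_const; near=> n.
  have : `|ln (p n.+1)%:R - ln (p n)%:R - f n.+1| <= eps * f n.+1 by near: n.
  by rewrite ler_norml (psumS f n.+1); lra.
exists (Num.truncn (`|C1| + `|C2|)).+1 => //; exists p => // n.
have := truncnS_gt (`|C1| + `|C2|).
have := h1 n; have := h2 n; have := ler_norm C1; have := ler_norm C2.
have := normr_ge0 C1; have := normr_ge0 C2.
by rewrite ler_norml; lra.
Unshelve. all: by end_near. Qed.

(** Each word is the list of the first digits of a cylinder. *)
Fixpoint words (B : nat -> nat) (n : nat) : seq (seq nat) :=
  if n is m.+1 then [seq rcons w c | w <- words B m, c <- iota 1 (B m)]
  else [:: [::]].

Lemma size_words B n : size (words B n) = (\prod_(i < n) B i)%N.
Proof.
elim: n => [|n IH]; first by rewrite big_ord0.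
by rewrite /= size_allpairs IH size_iota big_ord_recr.
Qed.

Lemma mem_words B n (p : nat -> nat) : (forall i, (0 < p i <= B i)%N) ->
  mkseq p n \in words B n.
Proof.
move=> pB; elim: n => [|n IH]; first by rewrite inE.
rewrite mkseqS /=; apply/allpairsP; exists (mkseq p n, p n); split=> //=.
by rewrite mem_iota add1n ltnS.
Qed.

Lemma growth_class_prod_lb eps K (x : R) p n :
  pierce_expansion x p ->
  (forall n, `|ln (p n)%:R - psum f n.+1| <= K + eps * psum f n.+1) ->
  expR ((1 - eps) * psum2 f n - n%:R * K) <= \prod_(i < n) (p i)%:R.
Proof.
move=> xp h.
have pgt0 k : 0 < (p k)%:R :> R by rewrite ltr0n (pierce_expansion_gt0 _ _ xp).
elim: n => [|n IH].
  by rewrite /psum2 !big_ord0 mulr0 mul0r subr0 expR0.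
rewrite big_ord_recr/= psum2S -natr1.
rewrite (_ : _ - _ = (1 - eps) * psum2 f n - n%:R * K +
  ((1 - eps) * psum f n.+1 - K)); last by ring.
rewrite expRD ler_pM ?expR_ge0// -[leRHS]lnK ?posrE// ler_expR.
by have := h n; rewrite ler_norml; lra.
Qed.

(** The cover consists of the parts of the class with given first n digits.
    The first exponential bounds their number, and r their diameters,
    by pierce_cylinder_dist with c = exp((1 - eps) psum f n.+1 - K). *)
Lemma hausdorff_premeasure_growth_class eps K s delta n : 0 <= s ->
  let r := expR (n.+1%:R * K - (1 - eps) * (psum2 f n + psum f n.+1)) in
  r <= delta ->
  (hausdorff_premeasure s delta (growth_class eps K) <=
   (expR ((1 + eps) * psum2 f n + n%:R * K) * r `^ s)%:E)%E.
Proof.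
move=> s0 r rd.
pose b j : R := expR (K + (1 + eps) * psum f j.+1).
pose B j := Num.truncn (b j).
have Bb j : (B j)%:R <= b j by rewrite /B truncn_le expR_ge0.
pose F (w : seq nat) := [set x : R | exists2 p, pierce_expansion x p &
  (forall n, `|ln (p n)%:R - psum f n.+1| <= K + eps * psum f n.+1) /\
  mkseq p n = w].
apply: (@le_trans _ _ ((size (words B n))%:R * r `^ s)%:E); last first.
  rewrite lee_fin ler_wpM2r ?powR_ge0// size_words natr_prod.
  have -> : expR ((1 + eps) * psum2 f n + n%:R * K) = \prod_(j < n) b j.
    rewrite /b -expR_sum; congr expR.
    by rewrite big_split /= sumr_const card_ord mulr_sumr mulr_natl addrC.
  by apply: ler_prod => i _; rewrite ler0n Bb.
apply: (@hausdorff_premeasure_finite_cover _ _ _ _ _ _ F) => //.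
- by rewrite expR_ge0.
- move=> x [p xp h]; exists (mkseq p n); last by exists p.
  apply: mem_words => i; have pi0 := pierce_expansion_gt0 _ _ xp i.
  rewrite pi0 /= /B truncn_ge_nat ?expR_ge0// /b.
  rewrite -[leLHS]lnK ?posrE ?ltr0n// ler_expR.
  by have := h i; rewrite ler_norml; lra.
move=> w _; apply: diameter_le; first exact: expR_ge0.
move=> x y [p xp [hp pw]] [q yq [hq qw]].
have pq i : (i < n)%N -> p i = q i.
  by move=> i_n; rewrite -(nth_mkseq 0%N p i_n) pw -qw nth_mkseq.
pose c : R := expR ((1 - eps) * psum f n.+1 - K).
have cle k : (0 < k)%N ->
    `|ln (k%:R : R) - psum f n.+1| <= K + eps * psum f n.+1 -> c <= k%:R.
  move=> k0 hk; rewrite -[leRHS]lnK ?posrE ?ltr0n// ler_expR.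
  by move: hk; rewrite ler_norml; lra.
apply: (le_trans (pierce_cylinder_dist _ _ _ _ _ c xp yq pq 
  (cle _ (pierce_expansion_gt0 _ _ xp n) (hp n))
  (cle _ (pierce_expansion_gt0 _ _ yq n) (hq n)) (expR_gt0 _))).
have -> : r = c^-1 * (expR ((1 - eps) * psum2 f n - n%:R * K))^-1.
  by rewrite /r /c -!expRN -expRD -natr1; congr expR; ring.
rewrite ler_wpM2l ?invr_ge0 ?expR_ge0// lef_pV2 ?posrE ?expR_gt0//.
  exact: growth_class_prod_lb xp hp.
by apply: prodr_gt0 => i _; rewrite ltr0n (pierce_expansion_gt0 _ _ xp).
Qed.

(** At a scale n with t psum2 f n <= psum f n.+1 the exponent of the total cost
    is at most - c psum2 f n + (1 + s) (n + 1) K, where c > 0 is the slack in the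
    hypothesis on s; the linear term is negligible, as psum2 f n is superlinear. *)
Lemma growth_class_null eps K s t : 0 < eps < 1 -> 0 <= K -> 0 <= s ->
  1 + eps < s * (1 - eps) * (1 + t) ->
  (forall N, exists2 n, (N <= n)%N & t * psum2 f n <= psum f n.+1) ->
  hausdorff_measure s (growth_class eps K) = 0.
Proof.
move=> /andP[e0 e1] K0 s0 st freq; apply: hausdorff_measure_eq0 => delta d0.
apply/lee_addgt0Pr => e e_gt0; rewrite add0e.
set c := s * (1 - eps) * (1 + t) - (1 + eps).
have c0 : 0 < c by rewrite /c; lra.
(* Beyond N1 the linear terms of the cost are absorbed, and beyond N2 those of
   the bound on the diameters. *)
have [N1 _ h1] := psum2_superlinear f (((1 + s) * K + `|ln e|) / c) f_cvg.
have [N2 _ h2] := psum2_superlinear f ((K + `|ln delta|) / (1 - eps)) f_cvg.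
have [n Nn tn] := freq (maxn N1 N2).
have {}h1 := h1 n (leq_trans (leq_maxl _ _) Nn).
have {}h2 := h2 n (leq_trans (leq_maxr _ _) Nn).
move: h1; rewrite mulrAC ler_pdivrMr// => h1.
move: h2; rewrite mulrAC ler_pdivrMr ?subr_gt0// => h2.
have n1 : 1 <= n.+1%:R :> R by rewrite ler1n.
have P0 := psum_ge0 f n.+1 f_gt0; have S0 := psum2_ge0 f n f_gt0.
have r_le : expR (n.+1%:R * K - (1 - eps) * (psum2 f n + psum f n.+1)) <= delta.
  rewrite -[leRHS]lnK ?posrE// ler_expR.
  have := ler_norm (- ln delta); rewrite normrN => a1.
  have a2 : `|ln delta| <= `|ln delta| * n.+1%:R by rewrite ler_peMr.
  have a3 : 0 <= (1 - eps) * psum f n.+1 by rewrite mulr_ge0// subr_ge0 ltW.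
  lra.
apply: (le_trans (hausdorff_premeasure_growth_class _ K _ _ n s0 r_le)).
rewrite lee_fin -expRM -expRD -[leRHS]lnK ?posrE// ler_expR.
have := ler_norm (- ln e); rewrite normrN => a1.
have a2 : `|ln e| <= `|ln e| * n.+1%:R by rewrite ler_peMr.
have a3 : s * (1 - eps) * (t * psum2 f n) <= s * (1 - eps) * psum f n.+1.
  by rewrite ler_wpM2l// mulr_ge0// subr_ge0 ltW.
have a4 : n%:R * K <= n.+1%:R * K by rewrite ler_wpM2r// ler_nat.
move: h1 a3; rewrite /c; lra.
Qed.

Lemma pierce_growth_null phi s t : (forall n, phi n.+2 = f n.+1) ->
  0 <= s -> 1 < s * (1 + t) ->
  (forall N, exists2 n, (N <= n)%N & t * psum2 f n <= psum f n.+1) ->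
  hausdorff_measure s (pierce_growth phi) = 0.
Proof.
move=> phif s0 st freq; set sigma := s * (1 + t) in st.
(* With this value (1 - eps) sigma - (1 + eps) = (sigma - 1) / 2 > 0. *)
pose eps := (sigma - 1) / (2 * (sigma + 1)).
have d0 : 0 < 2 * (sigma + 1) by lra.
have epsE : eps * (sigma + 1) = (sigma - 1) / 2.
  by rewrite /eps; field; rewrite gt_eqF//; lra.
have e0 : 0 < eps by rewrite divr_gt0//; lra.
have e1 : eps < 1 by rewrite ltr_pdivrMr//; lra.
apply: hausdorff_measure_sub_null (growth_class_cover _ _ e0 phif) _.
apply: hausdorff_measure_bigcup_null => K.
apply: (growth_class_null _ _ _ t) => //; first by rewrite e0.
rewrite (_ : s * _ * _ = (1 - eps) * sigma); last by rewrite /sigma; ring.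
lra.
Qed.

End Upper.

(** * Mixed radix expansions *)

Section MixedRadix.
Context {R : realType}.
Variable a : nat -> nat.
Hypothesis a_gt1 : forall k, (1 < a k)%N.
Implicit Types t u : R.

Fixpoint radix_rem t n : R :=
  if n is m.+1 then
    (a m)%:R * radix_rem t m - (Num.truncn ((a m)%:R * radix_rem t m))%:R
  else t.

Definition radix_digit t n := Num.truncn ((a n)%:R * radix_rem t n).

Lemma radix_gt0 n : 0 < (a n)%:R :> R.
Proof. by rewrite ltr0n; exact: ltnW. Qed.

Lemma radix_rem_itv t n : 0 <= t < 1 -> 0 <= radix_rem t n < 1.
Proof.
move=> t01; elim: n => //= n /andP[r0 _].
have /andP[] : (Num.truncn ((a n)%:R * radix_rem t n))%:R <=
    (a n)%:R * radix_rem t n < (Num.truncn ((a n)%:R * radix_rem t n)).+1%:R.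
  by apply: truncn_itv; rewrite mulr_ge0.
by rewrite -natr1; lra.
Qed.

Lemma radix_digit_lt t n : 0 <= t < 1 -> (radix_digit t n < a n)%N.
Proof.
move=> /radix_rem_itv-/(_ n)/andP[r0 r1].
rewrite /radix_digit truncn_lt_nat ?mulr_ge0//.
by rewrite gtr_pMr ?radix_gt0.
Qed.

Lemma radix_prod_gt0 n : 0 < \prod_(i < n) (a i)%:R :> R.
Proof. by apply: prodr_gt0 => i _; exact: radix_gt0. Qed.

(** On the numbers with given first n digits, t |-> radix_rem t n is affine and
    its slope is the product of the first n radices. *)
Lemma radix_subE t u n : (forall i, (i < n)%N -> radix_digit t i = radix_digit u i) ->
  t - u = (radix_rem t n - radix_rem u n) / \prod_(i < n) (a i)%:R.
Proof.
elim: n => [|n IH] h; first by rewrite big_ord0 divr1.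
rewrite IH => [|i i_n]; last by rewrite h// ltnW.
rewrite /= -!/(radix_digit _ _) h// big_ord_recr/=.
have := radix_gt0 n; have := radix_prod_gt0 n => p0 a0.
by field; rewrite !gt_eqF.
Qed.

Lemma radix_dist_le t u n : 0 <= t < 1 -> 0 <= u < 1 ->
  (forall i, (i < n)%N -> radix_digit t i = radix_digit u i) ->
  `|t - u| <= (`|(radix_digit t n)%:R - (radix_digit u n)%:R| + 1)
              / \prod_(i < n.+1) (a i)%:R.
Proof.
move=> t01 u01 h; rewrite (radix_subE _ _ _ h) big_ord_recr/=.
have a0 := radix_gt0 n; have p0 := radix_prod_gt0 n.
have /andP[t0 t1] := radix_rem_itv _ n.+1 t01.
have /andP[u0 u1] := radix_rem_itv _ n.+1 u01.
rewrite (_ : radix_rem t n - radix_rem u n =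
  ((radix_digit t n)%:R - (radix_digit u n)%:R +
   (radix_rem t n.+1 - radix_rem u n.+1)) / (a n)%:R); last first.
  by rewrite /= -!/(radix_digit _ _); field; rewrite gt_eqF.
rewrite -mulrA -invfM normrM [X in _ * X <= _]gtr0_norm; last first.
  by rewrite invr_gt0 mulr_gt0.
rewrite (mulrC (a n)%:R) ler_pM2r ?invr_gt0 ?mulr_gt0//.
by rewrite (le_trans (ler_normD _ _))// lerD2l ler_norml; lra.
Qed.

Lemma radix_digit_inj t u : 0 <= t < 1 -> 0 <= u < 1 ->
  radix_digit t =1 radix_digit u -> t = u.
Proof.
move=> t01 u01 tu; apply/eqP; rewrite -subr_eq0 -normr_le0.
apply/ler_addgt0Pr => e e0; rewrite add0r.
have [N _ h] := near_ge_nat (e^-1).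
have {h} := h N (leqnn N) => eN.
rewrite (le_trans (radix_dist_le _ _ N t01 u01 (fun i _ => tu i)))//.
rewrite tu subrr normr0 add0r mul1r invf_ple ?posrE ?radix_prod_gt0//.
rewrite (le_trans eN)//.
elim: N {eN} => [|N IH]; first exact/ltW/radix_prod_gt0.
rewrite big_ord_recr/= -natr1.
have a2 : 2 <= (a N.+1)%:R :> R by rewrite ler_nat.
have a1 : 1 <= \prod_(i < N.+1) (a i)%:R :> R.
  rewrite -(natr_prod) ler1n prodn_gt0// => i; exact: ltnW.
nra.
Qed.

End MixedRadix.

(** * Lower bound: a Cantor subset and a Hoelder estimate *)

Section Lower.
Context {R : realType}.
Variable f : nat -> R.
Hypothesis f_gt0 : forall k, 0 < f k.
Hypothesis f_cvg : f n @[n --> \oo] --> +oo.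

Implicit Types (u v x y s t : R) (phi : nat -> R).

(** Rounding exp (f k) up to an integer changes its logarithm by at most ln 2. *)
Definition factor k := (Num.truncn (expR (f k))).+1.

(** The factors 2 make radix k.+1 at least 4 radix k. Thus the digits
    cantor_digit below increase, and fast enough for pierce_digit_separation. *)
Definition radix k := (\prod_(i < k.+1) (2 * factor i))%N.

Lemma factor_gt1 k : (1 < factor k)%N.
Proof. by rewrite ltnS truncn_gt0 ltW// expR_gt1. Qed.

Lemma ln_factor k : f k <= ln (factor k)%:R <= f k + ln 2.
Proof.
have f0 : 0 < (factor k)%:R :> R by rewrite ltr0n.
apply/andP; split.
  by rewrite -ler_expR lnK ?posrE// ltW// truncnS_gt.
rewrite -ler_expR lnK ?posrE// expRD lnK ?posrE//.
have : (Num.truncn (expR (f k)))%:R <= expR (f k) by rewrite truncn_le expR_ge0.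
have : 1 < expR (f k) by rewrite expR_gt1.
by rewrite /factor -natr1; lra.
Qed.

Lemma radix_gt1 k : (1 < radix k)%N.
Proof.
rewrite /radix big_ord_recr/=.
have : (0 < \prod_(i < k) (2 * factor i))%N by rewrite prodn_gt0.
by have := factor_gt1 k; move: (factor k) (\prod_(i < k) _)%N => m P; nia.
Qed.

Lemma radixS k : radix k.+1 = (radix k * (2 * factor k.+1))%N.
Proof. by rewrite /radix big_ord_recr. Qed.

Lemma radixS_ge k : (4 * radix k <= radix k.+1)%N.
Proof. by rewrite radixS; have := factor_gt1 k.+1; nia. Qed.

Lemma ln_radixS k :
  ln (radix k.+1)%:R = ln (radix k)%:R + ln 2 + ln (factor k.+1)%:R :> R.
Proof.
have r0 : (0 < radix k)%N := ltnW (radix_gt1 k).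
by rewrite radixS !natrM !lnM ?posrE ?mulr_gt0 ?ltr0n// addrA.
Qed.

Lemma ln_radix_bounds k :
  psum f k.+1 <= ln (radix k)%:R <= psum f k.+1 + k.+1%:R * (2 * ln 2).
Proof.
have l2 : 0 < ln 2 :> R by rewrite ln_gt0// ltr1n.
elim: k => [|k /andP[l u]].
  rewrite /radix /psum !big_ord1 natrM lnM ?posrE ?ltr0n//.
  by have := ln_factor 0; lra.
rewrite ln_radixS psumS; have := ln_factor k.+1.
rewrite -(natr1 k.+1); lra.
Qed.

Lemma ln_prod_radix_ge n : psum2 f n <= ln (\prod_(i < n) (radix i)%:R).
Proof.
elim: n => [|n IH]; first by rewrite /psum2 !big_ord0 ln1.
rewrite psum2S big_ord_recr/= lnM ?posrE; last 2 first.
- by apply: prodr_gt0 => i _; rewrite ltr0n ltnW// radix_gt1.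
- by rewrite ltr0n ltnW// radix_gt1.
by have := ln_radix_bounds n; lra.
Qed.

(** In logarithms, ln (radix n) is at most psum f n.+1 up to a linear term and
    the logarithm of the product of the first n radices is at least psum2 f n,
    so, as s <= 1, it is enough that s (psum2 f n + psum f n.+1) + O(n) is at most
    psum2 f n for large n. Since s (1 + t) < 1, this follows from the superlinear
    growth of psum2 f n. *)
Lemma radix_holder_const (s t : R) : 0 <= s -> s <= 1 -> s * (1 + t) < 1 ->
  (\forall n \near \oo, psum f n.+1 <= t * psum2 f n) ->
  exists2 C : R, 0 < C & forall n, 2 / \prod_(i < n) (radix i)%:R <=
    C * ((2 ^+ (n + 3) * \prod_(i < n.+1) (radix i)%:R)^-1) `^ s.
Proof.
move=> s0 s1 st ft.
have l2 : 0 < ln 2 :> R by rewrite ln_gt0// ltr1n.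
pose P n : R := \prod_(i < n) (radix i)%:R.
have P0 n : 0 < P n.
  by apply: prodr_gt0 => i _; rewrite ltr0n ltnW// radix_gt1.
pose L n : R := ln 2 - ln (P n) + s * ((n + 3)%:R * ln 2 + ln (P n.+1)).
have [c Lc] : exists c, forall n, L n <= c.
  apply: (near_bounded_everywhere _ 0).
  have d0 : 0 < 1 - s * (1 + t) by lra.
  near=> n.
  have h1 : psum f n.+1 <= t * psum2 f n by near: n.
  (* The linear terms add up to at most (3 n + 6) ln 2 <= 7 (n + 1) ln 2. *)
  have : 7 * ln 2 / (1 - s * (1 + t)) * n.+1%:R <= psum2 f n.
    by near: n; exact: psum2_superlinear.
  rewrite mulrAC ler_pdivrMr// => h2.
  have h3 := ln_prod_radix_ge n; rewrite -/(P n) in h3.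
  have /andP[_ h4] := ln_radix_bounds n.
  rewrite /L {2}/P big_ord_recr/= -/(P n) lnM ?posrE//; last first.
    by rewrite ltr0n ltnW// radix_gt1.
  have h5 : s * ln (radix n)%:R <=
      s * (t * psum2 f n) + s * (n.+1%:R * (2 * ln 2)).
    by rewrite -mulrDr ler_wpM2l//; lra.
  have h6 : (1 - s) * psum2 f n <= (1 - s) * ln (P n) by rewrite ler_wpM2l//; lra.
  have h7 : s * ((n + 3)%:R * ln 2) <= (n + 3)%:R * ln 2.
    by apply: ler_piMl => //; apply: mulr_ge0 => //; exact: ltW.
  have h8 : s * (n.+1%:R * (2 * ln 2)) <= n.+1%:R * (2 * ln 2).
    by apply: ler_piMl => //; apply: mulr_ge0 => //; apply: mulr_ge0 => //; exact: ltW.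
  have h9 : 0 <= n%:R * ln 2 :> R by apply: mulr_ge0 => //; exact: ltW.
  move: h2 h5 h6 h7 h8; rewrite natrD -natr1; lra.
exists (expR c) => [|n]; first exact: expR_gt0.
rewrite -/(P n) -/(P n.+1).
have q0 : 0 < 2 ^+ (n + 3) * P n.+1 by rewrite mulr_gt0 ?exprn_gt0.
have r0 : 0 < (2 ^+ (n + 3) * P n.+1)^-1 `^ s by rewrite powR_gt0// invr_gt0.
set w := (_ `^ s) in r0 *; rewrite -[w]lnK ?posrE//.
rewrite -[leLHS]lnK ?posrE ?divr_gt0// -expRD ler_expR.
rewrite /w ln_powR lnV ?posrE// lnM ?posrE ?exprn_gt0// lnXn// ln_div ?posrE//.
by rewrite -(mulr_natl (ln 2)); have := Lc n; rewrite /L; lra.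
Unshelve. all: by end_near. Qed.

(** There are exactly radix k choices for this digit, so the logarithm of the
    number of words of length n matches that of the product of their digits up
    to a term linear in n. *)
Definition cantor_digit (u : R) k := (radix k + radix_digit radix u k)%N.

Lemma cantor_digit_ge u k : (radix k <= cantor_digit u k)%N.
Proof. exact: leq_addr. Qed.

Lemma cantor_digit_lt u k : 0 <= u < 1 -> (cantor_digit u k < 2 * radix k)%N.
Proof.
by move=> u01; rewrite mul2n -addnn ltn_add2l; exact: radix_digit_lt radix_gt1 _ _ u01.
Qed.

Lemma radix_pos k : 0 < (radix k)%:R :> R.
Proof. exact: radix_gt0 radix_gt1 k. Qed.

Lemma cantor_digit_gt0 u k : 0 < (cantor_digit u k)%:R :> R.
Proof. by rewrite (lt_le_trans (radix_pos k))// ler_nat cantor_digit_ge. Qed.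

Lemma cantor_digit_le2 u k : 0 <= u < 1 -> (cantor_digit u k)%:R <= 2 * (radix k)%:R :> R.
Proof. by move=> u01; rewrite -natrM ler_nat ltnW// cantor_digit_lt. Qed.

Lemma cantor_expansion_exists u : 0 <= u < 1 ->
  exists x : R, pierce_expansion x (cantor_digit u).
Proof.
move=> u01; apply: pierce_expansion_exists.
  by rewrite -(ltr0n R) cantor_digit_gt0.
move=> k; rewrite addn1 (leq_trans (cantor_digit_lt _ k u01))//.
rewrite (leq_trans _ (cantor_digit_ge u k.+1))// (leq_trans _ (radixS_ge k))//.
by rewrite leq_pmul2r// ltnW// radix_gt1.
Qed.

Lemma cantor_pierce_growth phi u x : (forall n, phi n.+2 = f n.+1) ->
  phi n @[n --> \oo] --> +oo -> 0 <= u < 1 ->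
  pierce_expansion x (cantor_digit u) -> pierce_growth phi x.
Proof.
move=> phif phioo u01 xu; exists (cantor_digit u) => //.
apply: (cvg_bounded_perturbation _ (fun n => phi n.+2) _ (3 * ln 2)) => [n||].
- rewrite phif ln_div ?posrE ?cantor_digit_gt0//.
  have lnp k : ln (radix k)%:R <= ln ((cantor_digit u k)%:R : R) <=
      ln 2 + ln (radix k)%:R.
    rewrite -lnM ?posrE ?radix_pos// !ler_ln ?posrE ?mulr_gt0 ?radix_pos ?cantor_digit_gt0//.
    by rewrite cantor_digit_le2// andbT ler_nat cantor_digit_ge.
  have := lnp n; have := lnp n.+1; rewrite ln_radixS.
  have l2 : 0 < ln 2 :> R by rewrite ln_gt0// ltr1n.
  by have := ln_factor n.+1; rewrite ler_norml; lra.
- exact: cvgry_shift2.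
- apply: (@cvg_trans _ ((fun=> 1 : R) @ \oo)); last exact: cvg_cst.
  by apply: near_eq_cvg; near=> n; rewrite divff// phif gt_eqF.
Unshelve. all: by end_near. Qed.

(** The separation estimate with all digits replaced by their bounds
    2 radix i; the exponent n + 3 collects n factors 2 from the common digits and
    8 = 2 * 2 * 2 from the denominator in pierce_digit_separation. *)
Lemma cantor_dist_ge u v x y n : 0 <= u < 1 -> 0 <= v < 1 ->
  pierce_expansion x (cantor_digit u) -> pierce_expansion y (cantor_digit v) ->
  (forall i, (i < n)%N -> radix_digit radix u i = radix_digit radix v i) ->
  (radix_digit radix u n < radix_digit radix v n)%N ->
  ((radix_digit radix v n)%:R - (radix_digit radix u n)%:R) / (radix n)%:R *
    (2 ^+ (n + 3) * \prod_(i < n.+1) (radix i)%:R)^-1 <= `|x - y|.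
Proof.
move=> u01 v01 xu yv uv uvn.
have pq i : (i < n)%N -> cantor_digit u i = cantor_digit v i.
  by move=> i_n; rewrite /cantor_digit uv.
have pqn : (cantor_digit u n < cantor_digit v n)%N by rewrite ltn_add2l.
apply: le_trans (pierce_digit_separation n _ _ _ _ xu yv pq pqn _); last first.
  rewrite (leq_trans (leq_mul (leqnn 2) (cantor_digit_lt _ _ u01)))//.
  by rewrite (leq_trans _ (cantor_digit_ge u n.+1))// mulnA radixS_ge.
have -> : (cantor_digit v n)%:R - (cantor_digit u n)%:R =
    (radix_digit radix v n)%:R - (radix_digit radix u n)%:R :> R.
  by rewrite /cantor_digit !natrD opprD addrACA subrr add0r.
have prodP : \prod_(i < n) (cantor_digit u i)%:R <=
    2 ^+ n * \prod_(i < n) (radix i)%:R :> R.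
  rewrite -[X in 2 ^+ X]card_ord -prodr_const -big_split/=.
  by apply: ler_prod => i _; rewrite ler0n cantor_digit_le2.
have pp0 : 0 < \prod_(i < n) (cantor_digit u i)%:R :> R.
  by apply: prodr_gt0 => i _; exact: cantor_digit_gt0.
rewrite -2!mulrA ler_pM2l ?subr_gt0 ?ltr_nat//.
have u0 := cantor_digit_gt0 u n; have v0 := cantor_digit_gt0 v n.
rewrite -!invfM lef_pV2 ?posrE ?mulr_gt0 ?exprn_gt0//; last 2 first.
- exact: radix_pos.
- by apply: prodr_gt0 => i _; exact: radix_pos.
rewrite big_ord_recr/= exprD.
rewrite (_ : (radix n)%:R * _ = (2 * (2 * (radix n)%:R) * (2 * (radix n)%:R)) *
  (2 ^+ n * \prod_(i < n) (radix i)%:R)); last by ring.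
by rewrite !ler_pM ?mulr_ge0 ?(ltW u0) ?(ltW v0) ?(ltW pp0) ?cantor_digit_le2.
Qed.

(** Let D be the difference of the first digits that differ. Then |u - v| is at
    most 2 D / (a_1 ... a_n), while |x - y| is at least D / a_n times the length
    whose s-th power is bounded from below by radix_holder_const. As D <= a_n and
    s <= 1, D / a_n is at most (D / a_n)^s. *)
Lemma cantor_holder (s C u v x y : R) : 0 <= s -> s <= 1 -> 0 < C ->
  (forall n, 2 / \prod_(i < n) (radix i)%:R <=
    C * ((2 ^+ (n + 3) * \prod_(i < n.+1) (radix i)%:R)^-1) `^ s) ->
  0 <= u < 1 -> 0 <= v < 1 ->
  pierce_expansion x (cantor_digit u) -> pierce_expansion y (cantor_digit v) ->
  `|u - v| <= C * `|x - y| `^ s.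
Proof.
move=> s0 s1 C0 HC u01 v01 xu yv.
have [->|uv] := eqVneq u v.
  by rewrite subrr normr0 mulr_ge0 ?powR_ge0// ltW.
have : exists n, radix_digit radix u n != radix_digit radix v n.
  apply: contrapT => h; move/eqP: uv; apply.
  apply: (radix_digit_inj _ radix_gt1) => // n; apply: contrapT => /eqP hn.
  by apply: h; exists n.
move=> /ex_minnP[n un nmin].
have agree i : (i < n)%N -> radix_digit radix u i = radix_digit radix v i.
  by move=> i_n; apply/eqP/negPn/negP => /nmin; rewrite leqNgt i_n.
wlog ltn : u v x y u01 v01 xu yv uv un nmin agree /
    (radix_digit radix u n < radix_digit radix v n)%N.
  move=> hwlog; move: (un); rewrite neq_ltn => /orP[uvn|uvn]; first exact: hwlog.
  rewrite distrC (distrC x); apply: hwlog => //.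
  - by rewrite eq_sym.
  - by rewrite eq_sym.
  - by move=> m; rewrite eq_sym; exact: nmin.
  - by move=> i i_n; rewrite agree.
have dist := radix_dist_le _ radix_gt1 u v n u01 v01 agree.
have sep := cantor_dist_ge _ _ _ _ n u01 v01 xu yv agree ltn.
have vr := radix_digit_lt _ radix_gt1 v n v01.
have r0 := radix_pos n.
have D1 : 1 <= (radix_digit radix v n)%:R - (radix_digit radix u n)%:R :> R.
  by rewrite lerBrDr addrC natr1 ler_nat.
have Dr : (radix_digit radix v n)%:R - (radix_digit radix u n)%:R <= (radix n)%:R :> R.
  by rewrite lerBlDr -natrD ler_nat (leq_trans (ltnW vr))// leq_addr.
move: dist sep; rewrite (distrC (radix_digit radix u n)%:R).
rewrite (ger0_norm (le_trans ler01 D1)).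
move: (_ - (radix_digit radix u n)%:R) D1 Dr => D D1 Dr dist sep.
rewrite big_ord_recr/= in dist; apply: (le_trans dist).
have P0 : 0 < \prod_(i < n) (radix i)%:R :> R.
  by apply: prodr_gt0 => i _; exact: radix_pos.
have Q0 : 0 <= (2 ^+ (n + 3) * \prod_(i < n.+1) (radix i)%:R)^-1 :> R.
  by rewrite invr_ge0 mulr_ge0 ?exprn_ge0// prodr_ge0.
have Dr0 : 0 < D / (radix n)%:R by rewrite divr_gt0// (lt_le_trans ltr01).
apply: (@le_trans _ _ (C * (D / (radix n)%:R *
    (2 ^+ (n + 3) * \prod_(i < n.+1) (radix i)%:R)^-1) `^ s)); last first.
  rewrite ler_pM2l//; apply: ge0_ler_powR; rewrite ?nnegrE//.
  by rewrite mulr_ge0// ltW.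
rewrite powRM//; last exact: ltW.
rewrite mulrCA.
apply: (@le_trans _ _ ((D / (radix n)%:R) * (2 / \prod_(i < n) (radix i)%:R))); last first.
  apply: ler_pM => //; [exact: ltW|by rewrite divr_ge0// ltW|].
  by apply: ger1_powR => //; rewrite Dr0 ler_pdivrMr// mul1r.
rewrite (_ : D / _ * _ = (2 * D) / (\prod_(i < n) (radix i)%:R * (radix n)%:R)); last first.
  by field; rewrite !gt_eqF.
by rewrite ler_pM2r ?invr_gt0 ?mulr_gt0//; lra.
Qed.

Lemma pierce_growth_measure_neq0 phi (s t : R) : (forall n, phi n.+2 = f n.+1) ->
  phi n @[n --> \oo] --> +oo ->
  0 <= s -> s <= 1 -> s * (1 + t) < 1 ->
  (\forall n \near \oo, psum f n.+1 <= t * psum2 f n) ->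
  hausdorff_measure s (pierce_growth phi) <> 0.
Proof.
move=> phif phioo s0 s1 st ft.
have [C C0 HC] := radix_holder_const _ _ s0 s1 st ft.
have /choice[g gP] : forall u, exists x : R,
    0 <= u < 1 -> pierce_expansion x (cantor_digit u).
  move=> u; have [/cantor_expansion_exists[x xu]|nu] := pselect (0 <= u < 1).
    by exists x.
  by exists 0 => /nu.
apply: (hausdorff_measure_holder_neq0 _ _ g C) => // [u u01|u v u01 v01].
  exact: (cantor_pierce_growth _ u _ phif phioo u01 (gP _ u01)).
exact: (cantor_holder _ _ _ _ _ _ s0 s1 C0 HC u01 v01 (gP _ u01) (gP _ v01)).
Qed.

End Lower.

(** * The dimension *)

Theorem corollary6p2 (R : realType) (phi : nat -> R)
  (phi_gt0 : forall n : nat, (1 <= n)%N -> 0 < phi n)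
  (phi_cvg : phi n @[n --> \oo] --> +oo) :
  let perron_set : set R :=
    [set x : R | [/\ 0 < x < 1, irrational x &
      ln ((pierce_perron_digit n x)%:R / (pierce_perron_digit n.-1 x)%:R)
        / phi n @[n --> \oo] --> (1 : R)]] in
  let traditional_set : set R :=
    [set x : R | [/\ 0 < x < 1, irrational x &
      ln ((pierce_digit n x)%:R / (pierce_digit n.-1 x)%:R)
        / phi n @[n --> \oo] --> (1 : R)]] in
  (* limit superior in the extended reals *)
  let theta : \bar R :=
    limn_esup (fun n : nat =>
      ((\sum_(1 <= k < n.+2) phi k)
        / (\sum_(1 <= k < n.+1) (n - k + 1)%N%:R * phi k))%:E) in
  (* the extended-real inverse satisfies +oo^-1 = 0 *)
  perron_set = traditional_set /\
  hausdorff_dim perron_set = ((1 + theta)^-1)%E.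
Proof.
move=> perron_set traditional_set theta.
have perronE : perron_set = pierce_growth phi by exact: perron_setE.
split; first by rewrite perronE -traditional_setE.
rewrite perronE {perron_set traditional_set perronE}.
pose f k := phi k.+1.
have f_gt0 k : 0 < f k by exact: phi_gt0.
have f_cvg : f n @[n --> \oo] --> +oo.
  apply: (@cvg_comp _ _ _ S phi _ \oo) => //.
  rewrite (_ : S = addn^~ 1%N); first exact: cvg_addnr.
  by apply/funext => n; rewrite addn1.
have phif n : phi n.+2 = f n.+1 by [].
have thetaE : theta = limn_esup (fun n => (psum f n.+1 / psum2 f n)%:E).
  by rewrite /theta; under eq_fun do rewrite psumE psum2E.
have S_gt0 n : (0 < n)%N -> 0 < psum2 f n.
  case: n => // n _; rewrite psum2S psumS.
  have := psum2_ge0 f n f_gt0; have := psum_ge0 f n f_gt0; have := f_gt0 n.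
  lra.
have theta_ge0 : (0 <= theta)%E.
  rewrite thetaE; apply: limf_esup_ge0 => [[N _ /(_ N (leqnn N))]|n] //.
  by rewrite lee_fin divr_ge0 ?psum_ge0 ?psum2_ge0.
have upper (s t : R) : 0 < s -> 1 < s * (1 + t) -> (t%:E < theta)%E ->
    (hausdorff_dim (pierce_growth phi) <= s%:E)%E.
  move=> s0 st tt; apply: hausdorff_dim_le; first exact: ltW.
  apply: (pierce_growth_null f f_gt0 f_cvg phi s t) => //; first exact: ltW.
  move=> N; move: tt; rewrite thetaE => /limn_esup_gt_frequently/(_ N.+1).
  move=> [n Nn]; rewrite lte_fin ltr_pdivlMr; last first.
    by apply: S_gt0; exact: leq_ltn_trans Nn.
  by move=> /ltW; exists n => //; exact: ltnW.
apply/eqP; rewrite eq_le; apply/andP; split.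
  apply/lee_addgt0Pr => e e0.
  have [theta_fin|theta_inf] := boolP (theta \is a fin_num); last first.
    have th : theta = +oo%E.
      by apply/eqP; rewrite -leye_eq leNgt -ge0_fin_numE.
    rewrite th addey// invey add0e; apply: (upper e e^-1) => //.
      by rewrite mulrDr mulr1 mulfV ?gt_eqF//; lra.
    by rewrite th ltry.
  have [r th] : exists r, theta = r%:E by exists (fine theta); rewrite fineK.
  have r0 : 0 <= r by rewrite -lee_fin -th.
  have r1 : 0 < 1 + r by lra.
  rewrite th -EFinD inver gt_eqF// -EFinD.
  have s0 : 0 < (1 + r)^-1 by rewrite invr_gt0.
  pose s := (1 + r)^-1 + e.
  have sr : s * (1 + r) = 1 + e * (1 + r) by rewrite /s; field; rewrite gt_eqF.
  have er : 0 < e * (1 + r) by rewrite mulr_gt0.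
  have s_gt0 : 0 < s by rewrite /s; lra.
  (* This value of t < r halves the excess of s (1 + r) over 1. *)
  apply: (upper s (r - (e * (1 + r)) / (2 * s))) => //.
    rewrite (_ : s * _ = s * (1 + r) - e * (1 + r) / 2); last first.
      by field; rewrite gt_eqF.
    by rewrite sr; lra.
  by rewrite th lte_fin ltrBlDr ltrDl divr_gt0// mulr_gt0.
apply: le_ereal_inf_tmp => _ [s [s0 sA] <-].
have [theta_fin|theta_inf] := boolP (theta \is a fin_num); last first.
  have -> : theta = +oo%E by apply/eqP; rewrite -leye_eq leNgt -ge0_fin_numE.
  by rewrite addey// invey lee_fin.
have [r th] : exists r, theta = r%:E by exists (fine theta); rewrite fineK.
have r0 : 0 <= r by rewrite -lee_fin -th.
have r1 : 0 < 1 + r by lra.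
rewrite th -EFinD inver gt_eqF// lee_fin.
rewrite leNgt; apply/negP => sr.
have {}sr : s * (1 + r) < 1 by rewrite -ltr_pdivlMr// mul1r.
have s1 : s <= 1 by nra.
(* Since s <= 1, s (1 + t) exceeds s (1 + r) by at most half of its gap below 1. *)
pose t := r + (1 - s * (1 + r)) / 2.
apply: (pierce_growth_measure_neq0 f f_gt0 f_cvg phi s t) => //.
  by rewrite /t; nra.
have : (theta < t%:E)%E by rewrite th lte_fin /t; lra.
rewrite thetaE => /limn_esup_lt_near; near_simpl => h.
near=> n.
have n0 : (0 < n)%N by near: n; exact: nbhs_infty_gt.
have : ((psum f n.+1 / psum2 f n)%:E < t%:E)%E by near: n.
by rewrite lte_fin ltr_pdivrMr ?S_gt0// => /ltW.
Unshelve. all: by end_near. Qed.
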